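(* For every equivalence class $\mathcal{C}\in\mathbb{Z}^*/\!\sim$ of finite sequences of integers, $$\min\big(\mathcal{C}^{\oplus}\big)=\bigcup_{M\in\min\mathcal{C}}M^{\oplus}.$$
   Context: $\mathbb{Z}^*$ is the set of finite sequences of integers, including the empty sequence $\varnothing$. Nested sequences denote concatenation. The blowings-up of a nonempty $X=(x_1,\dots,x_n)$ are $(-1,x_1-1,x_2,\dots,x_n)$, $(x_1,\dots,x_{i-1},x_i-1,-1,x_{i+1}-1,x_{i+2},\dots,x_n)$ for $1\le i<n$, and $(x_1,\dots,x_{n-1},x_n-1,-1)$; also $(-1)$ is the blowing-up of $\varnothing$. Blowing-down is the inverse. $\sim$ is the equivalence relation on $\mathbb{Z}^*$ generated by blowing-up; $\le$ is the partial order on $\mathbb{Z}^*$ generated by $X\le X'$ whenever $X'$ is a blowing-up of $X$. A sequence is minimal if it cannot be blown down, i.e. no term equals $-1$. For an equivalence class $\mathcal{C}$, $\min\mathcal{C}$ is the set of minimal sequences belonging to $\mathcal{C}$. For $B=(b_1,\dots,b_n)\in\mathbb{Z}^*$ and $x\in\mathbb{Z}$ put ${}_xB=(0,x,b_1,\dots,b_n)$ and $B_x=(b_1,\dots,b_n,x,0)$; if $B\ne\varnothing$, $1\le i\le n$ and $x+y=b_i$ put $B_{(i;x,y)}=(b_1,\dots,b_{i-1},x,0,y,b_{i+1},\dots,b_n)$. For a minimal sequence $M=(m_1,\dots,m_k)$, $M^{\oplus}$ is the set of sequences $Z$ obtained in one of the following ways: (1) pick $x\in\mathbb{Z}$ and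 let $Z$ be the unique minimal sequence with $Z\le{}_xM$; (2) pick $x\in\mathbb{Z}$ and let $Z$ be the unique minimal sequence with $Z\le M_x$; (3) if $M\ne\varnothing$, pick $j\in\{1,\dots,k\}$ and $x,y\in\mathbb{Z}$ with $x+y=m_j$, and let $Z$ be the unique minimal sequence with $Z\le M_{(j;x,y)}$; (4) pick $M'=(\mu_1,\dots,\mu_\ell)\ge M$ having exactly one term $\mu_j$ equal to $-1$, pick $x,y\in\mathbb{Z}\setminus\{-1\}$ with $x+y=-1$, and let $Z=M'_{(j;x,y)}$. For an equivalence class $\mathcal{C}$, the successor $\mathcal{C}^{\oplus}$ is the equivalence class of any $X\in M^{\oplus}$, where $M$ is any minimal element of $\mathcal{C}$ (this is independent of the choices of $M$ and $X$). *)

(* Defs.v *)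
From Stdlib Require Export Relation_Operators.
From mathcomp Require Export all_boot all_order all_algebra.
From mathcomp Require Export boolp classical_sets.
From mathcomp Require Import zify.

Set Implicit Arguments.
Unset Strict Implicit.
Unset Printing Implicit Defensive.

Import Order.TTheory GRing.Theory Num.Theory.

Local Open Scope classical_set_scope.
Local Open Scope ring_scope.

(** [blowup X X']: [X'] is a blowing-up of [X]. *)
Inductive blowup : seq int -> seq int -> Prop :=
| blowup_nil : blowup [::] [:: -1]
| blowup_first x s : blowup (x :: s) [:: -1, x - 1 & s]
| blowup_mid s x y t :
    blowup (s ++ [:: x, y & t]) (s ++ [:: x - 1, -1, y - 1 & t])
| blowup_last s x : blowup (s ++ [:: x]) (s ++ [:: x - 1; -1]).

Definition bequiv : seq int -> seq int -> Prop := clos_refl_sym_trans _ blowup.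

(** [ble] is antisymmetric because a blowing-up increases the length by one. *)
Definition ble : seq int -> seq int -> Prop := clos_refl_trans _ blowup.

Definition minimal (X : seq int) : Prop := forall Y, ~ blowup Y X.

Definition bclass (X : seq int) : set (seq int) := [set Y | bequiv X Y].

Definition bclasses : set (set (seq int)) := range bclass.

Definition minset (C : set (seq int)) : set (seq int) :=
  [set X | C X /\ minimal X].

Definition reduction_of (B Z : seq int) : Prop :=
  unique (fun Y => minimal Y /\ ble Y B) Z.

Definition extl (x : int) (B : seq int) : seq int := [:: 0, x & B].

Definition extr (B : seq int) (x : int) : seq int := B ++ [:: x; 0].

(** Positions are counted from 0; only meaningful if [i < size B] and
    [x + y = B`_i]. *)
Definition split_at (B : seq int) (i : nat) (x y : int) : seq int :=
  take i B ++ [:: x, 0, y & drop i.+1 B].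

Inductive oplus (M : seq int) : set (seq int) :=
| oplus_extl x Z : reduction_of (extl x M) Z -> oplus M Z
| oplus_extr x Z : reduction_of (extr M x) Z -> oplus M Z
| oplus_split j x y Z :
    (j < size M)%N -> x + y = M`_j ->
    reduction_of (split_at M j x y) Z -> oplus M Z
| oplus_blowup M' j x y :
    ble M M' -> count_mem (-1) M' = 1%N ->
    (j < size M')%N -> M'`_j = -1 ->
    x <> -1 -> y <> -1 -> x + y = -1 ->
    oplus M (split_at M' j x y).

(** The class of an arbitrarily chosen element of some [oplus M] with [M] in
    [minset C]; [successorE] and [oplus_minset_nonempty] show that a choice
    exists and that the result does not depend on it. *)
Definition successor (C : set (seq int)) : set (seq int) :=
  bclass (xget [::] (\bigcup_(M in minset C) oplus M)).

Lemma minimalP X : minimal X <-> -1 \notin X.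
Proof.
split=> [mX | nX Y bYX]; last first.
  by case: bYX nX => [|x s|s x y t|s x]; rewrite ?mem_cat !inE eqxx ?orbT.
apply/negP => inX; case/splitPr: inX mX => s t.
case: (lastP s) => [|{}s a]; case: t => [|b t] mX.
- exact: mX blowup_nil.
- by apply: (mX ((b + 1) :: t)); rewrite -{2}(addrK 1 b); apply: blowup_first.
- apply: (mX (s ++ [:: a + 1])); rewrite cat_rcons -{2}(addrK 1 a).
  exact: blowup_last.
- apply: (mX (s ++ [:: a + 1, b + 1 & t])).
  rewrite cat_rcons -{2}(addrK 1 a) -{2}(addrK 1 b).
  exact: blowup_mid.
Qed.

Lemma bequiv_sym X Y : bequiv X Y -> bequiv Y X.
Proof. exact: rst_sym. Qed.

Lemma bequiv_trans Y X Z : bequiv X Y -> bequiv Y Z -> bequiv X Z.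
Proof. exact: rst_trans. Qed.

Lemma ble_bequiv X Y : ble X Y -> bequiv X Y.
Proof.
elim=> [{}X {}Y h|{}X|{}X Z {}Y _ h1 _ h2]; first exact: rst_step.
  exact: rst_refl.
exact: bequiv_trans h1 h2.
Qed.

Lemma bequiv_join W X Y : blowup X W -> blowup Y W -> bequiv X Y.
Proof.
by move=> h1 h2; apply: (bequiv_trans (Y := W)); [|apply: bequiv_sym];
   apply: rst_step.
Qed.

Lemma bequiv_shift1 s (a b : int) t :
  bequiv (s ++ [:: a, 0, b & t]) (s ++ [:: a + 1, 0, b - 1 & t]).
Proof.
apply: (bequiv_join (W := s ++ [:: a, -1, -1, b - 1 & t])).
  by have := blowup_mid (rcons s a) 0 b t; rewrite !cat_rcons sub0r.
by have := blowup_mid s (a + 1) 0 (b - 1 :: t); rewrite addrK sub0r.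
Qed.

Lemma bequiv_shift z s (a b : int) t :
  bequiv (s ++ [:: a, 0, b & t]) (s ++ [:: a + z, 0, b - z & t]).
Proof.
elim: z => [|n IHn|n IHn]; first by rewrite addr0 subr0; apply: rst_refl.
  apply: bequiv_trans IHn _; have := bequiv_shift1 s (a + n%:Z) (b - n%:Z) t.
  by congr (bequiv _ (_ ++ [:: _, _, _ & _])); lia.
apply: bequiv_trans IHn _; apply: bequiv_sym.
have := bequiv_shift1 s (a + - n.+1%:Z) (b - - n.+1%:Z) t.
by congr (bequiv _ (_ ++ [:: _, _, _ & _])); lia.
Qed.

Lemma bequiv_extl x y B : bequiv (extl x B) (extl y B).
Proof.
have step z : bequiv (extl z B) (extl (z - 1) B).
  apply: (bequiv_join (W := [:: -1, -1, z - 1 & B])).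
    by have := blowup_mid [::] 0 z B; rewrite /= sub0r.
  by have := blowup_first 0 (z - 1 :: B); rewrite sub0r.
have zero z : bequiv (extl z B) (extl 0 B).
  elim: z => [|n IHn|n IHn]; first exact: rst_refl.
    apply: bequiv_trans (step _) _; move: IHn.
    by congr (bequiv (extl _ _) _); lia.
  apply: bequiv_trans (bequiv_sym _) IHn; have := step (- n%:Z).
  by congr (bequiv _ (extl _ _)); lia.
exact: bequiv_trans (zero x) (bequiv_sym (zero y)).
Qed.

Lemma bequiv_extr x y B : bequiv (extr B x) (extr B y).
Proof.
have step z : bequiv (extr B z) (extr B (z - 1)).
  apply: (bequiv_join (W := B ++ [:: z - 1; -1; -1])).
    by have := blowup_mid B z 0 [::]; rewrite /= sub0r.
  by have := blowup_last (rcons B (z - 1)) 0; rewrite !cat_rcons sub0r.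
have zero z : bequiv (extr B z) (extr B 0).
  elim: z => [|n IHn|n IHn]; first exact: rst_refl.
    apply: bequiv_trans (step _) _; move: IHn.
    by congr (bequiv (extr _ _) _); lia.
  apply: bequiv_trans (bequiv_sym _) IHn; have := step (- n%:Z).
  by congr (bequiv _ (extr _ _)); lia.
exact: bequiv_trans (zero x) (bequiv_sym (zero y)).
Qed.

Lemma bequiv_slide X t : bequiv (extl 0 (X ++ t)) (X ++ [:: 0, 0 & t]).
Proof.
elim/last_ind: X t => [|X b IHX] t; first exact: rst_refl.
rewrite cat_rcons; apply: bequiv_trans (IHX _) _; rewrite cat_rcons.
by have := bequiv_shift b X 0 b t; rewrite add0r subrr.
Qed.

Lemma bequiv_split B j x y : (j < size B)%N -> x + y = B`_j ->
  bequiv (extl 0 B) (split_at B j x y).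
Proof.
move=> ltj xy; apply: bequiv_sym.
apply: bequiv_trans (bequiv_shift y _ _ _ _) _; rewrite xy subrr.
rewrite -cat_rcons -take_nth //; apply: bequiv_sym.
by rewrite -{1}(cat_take_drop j.+1 B); apply: bequiv_slide.
Qed.

Lemma bequiv_extl0 X Y : bequiv X Y -> bequiv (extl 0 X) (extl 0 Y).
Proof.
elim=> [{}X {}Y h|{}X|{}X {}Y _|{}X Z {}Y _ h1 _ h2].
- case: h => [|x s|s x y t|s x].
  + apply: bequiv_trans (bequiv_extl 0 1 _) _.
    by apply: rst_step; have := blowup_last [:: 0] 1; rewrite subrr.
  + apply: bequiv_trans (bequiv_extl 0 1 _) _.
    by apply: rst_step; have := blowup_mid [:: 0] 1 x s; rewrite subrr.
  + exact/rst_step/(blowup_mid [:: 0, 0 & s]).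
  + exact/rst_step/(blowup_last [:: 0, 0 & s]).
- exact: rst_refl.
- exact: bequiv_sym.
- exact: bequiv_trans h1 h2.
Qed.

Lemma oplus_bequiv M X : oplus M X -> bequiv (extl 0 M) X.
Proof.
case=> [x Z [[_ /ble_bequiv ZM] _]|x Z [[_ /ble_bequiv ZM] _]
       |j x y Z ltj xy [[_ /ble_bequiv ZM] _]
       |M' j x y /ble_bequiv MM' _ ltj Mj _ _ xy].
- exact: bequiv_trans (bequiv_extl 0 x M) (bequiv_sym ZM).
- apply: bequiv_trans (bequiv_sym ZM).
  apply: bequiv_trans (bequiv_extr 0 x M).
  by have := bequiv_slide M [::]; rewrite cats0.
- exact: bequiv_trans (bequiv_split ltj xy) (bequiv_sym ZM).
- apply: bequiv_trans (bequiv_extl0 MM') (bequiv_split ltj _).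
  by rewrite xy Mj.
Qed.

Lemma minset_nonempty C : bclasses C -> minset C !=set0.
Proof.
case=> X _ <-; have [n] := ubnP (size X).
elim: n X => // n IHn X /ltnSE leX.
have [[Y bYX]|nX] := pselect (exists Y, blowup Y X); last first.
  exists X; split; first exact: rst_refl.
  by move=> Y bYX; apply: nX; exists Y.
have [|M [YM mM]] := IHn Y.
  by apply: leq_trans leX; case: bYX => *; rewrite ?size_cat /= ?addnS.
exists M; split=> //; apply: bequiv_trans YM.
exact/bequiv_sym/rst_step.
Qed.

Lemma minimal_ble X Y : minimal Y -> ble X Y -> X = Y.
Proof.
move=> mY bXY; elim: bXY mY => // [{}X {}Y h mY|{}X Z {}Y _ h1 _ h2 mY].
  by case: (mY X).
by move: (h2 mY) h1 => -> /(_ mY).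
Qed.

Lemma oplus_nonempty M : minimal M -> oplus M !=set0.
Proof.
move=> /minimalP nM; have mE : minimal (extl 0 M) by apply/minimalP.
exists (extl 0 M); apply: (oplus_extl (x := 0)); split=> [|Z [_ leZ]].
  by split=> //; apply: rt_refl.
exact/esym/minimal_ble.
Qed.

Lemma oplus_minset_nonempty C :
  bclasses C -> \bigcup_(M in minset C) oplus M !=set0.
Proof.
move=> /minset_nonempty[M CM]; have [X MX] := oplus_nonempty CM.2.
by exists X; exists M.
Qed.

Lemma successorE C M X :
  bclasses C -> minset C M -> oplus M X -> successor C = bclass X.
Proof.
move=> clC CM MX; rewrite /successor.
have [N [CN _] NY] : (\bigcup_(N in minset C) oplus N)
    (xget [::] (\bigcup_(N in minset C) oplus N)).
  by case: xgetP => // /(_ X) []; exists M.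
move: (xget _ _) NY => Y NY; have [X0 _ defC] := clC.
have MN : bequiv M N.
  by move: CM.1 CN; rewrite -defC => h; apply/bequiv_trans/bequiv_sym.
have YX : bequiv Y X.
  apply: bequiv_trans (oplus_bequiv MX).
  apply: bequiv_trans (bequiv_sym (oplus_bequiv NY)) _.
  exact/bequiv_extl0/bequiv_sym.
apply/seteqP; split=> Z; apply: bequiv_trans => //.
exact: bequiv_sym.
Qed.

(* Main.v *)
Require Import Defs.
From Stdlib Require Import Operators_Properties.
From mathcomp Require Import zify.

Set Implicit Arguments.
Unset Strict Implicit.
Unset Printing Implicit Defensive.

Import Order.TTheory GRing.Theory Num.Theory.

Local Open Scope classical_set_scope.
Local Open Scope ring_scope.

(** Every element of [oplus M] is equivalent to [(0, 0, M)], so both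
    inclusions are about minimal sequences equivalent to [(0, 0, M)].

    The inclusion from right to left only asks that members of [oplus M] be
    minimal. For the other one, let [Z] be minimal and equivalent to
    [(0, 0, M0)] with [M0] in [C]. Two facts suffice.

    First, [Z] lies in [oplus M] for some minimal [M]. As shown by the
    invariant below, [Z] is not [(0)] and has a term greater than [-1]. If [Z]
    has a zero, [Z] itself is an extension or a splitting, and [M] is read off
    by merging the neighbours of the zero; when they add up to [-1], the merged
    sequence has a single term [-1] and [M] is any minimal sequence below it
    ([oplus_of_zero]). If [Z] has no zero but a positive term [m], blowing up
    [m] times just to the right of this term turns it into [0]
    ([oplus_of_positive]). All intermediate sequences have exactly one term
    [-1], hence only one blowing-down, and this is why [Z] is the only minimal
    sequence below the result ([reduction_of_expand]).

    Second, [M] lies in [C], because [(0, 0, X) ~ (0, 0, Y)] implies [X ~ Y]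
    ([bequiv_extl_inj]). This is proved with a complete invariant. Let the
    braid group on two generators [a], [b] with [a b a = b a b =: D] act on the
    universal cover of the punctured plane, [a] being the lift of a shear and
    [D] the lift of a quarter turn. Since [D a^-1 D = a D a], the image
    [winding X] of a vector fixed by [a] under [D a^x1 D ... D a^xn D] is
    unchanged by blowing-up, except that a blowing-up at the left end
    multiplies it by [a]; and passing from [X] to [(0, 0, X)] multiplies it by
    the central element [D^2], a half turn, which is injective. Completeness
    follows from canonical forms: each sequence is equivalent to a sequence of
    all terms at most [-2] preceded by an even number of zeros, or to an odd
    number of zeros ([canonical_exists]), and the invariant tells these apart
    ([canonical_inj]), essentially because a rational number has only one
    negative continued fraction expansion. *)

(** * An invariant of the equivalence *)

(** [(p, q, n)] stands for the vector [(p, q)], taken above the horizontal axis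
    or on its positive half (this is [valid]), and rotated by [n] half turns: a
    point of the universal cover of the punctured plane. *)
Definition state : Type := (int * int * int)%type.

Definition valid (v : state) : bool :=
  let: (p, q, _) := v in (0 < q) || (q == 0) && (0 < p).

(** A shear fixes the horizontal axis, hence it preserves the number of half
    turns. *)
Definition shear (k : int) (v : state) : state :=
  let: (p, q, n) := v in (p - k * q, q, n).

(** The quarter turn; a vector that leaves the half-plane is replaced by its
    opposite, at the price of one more half turn. *)
Definition turn (v : state) : state :=
  let: (p, q, n) := v in if 0 < p then (- q, p, n) else (q, - p, n + 1).

(** The starting vector [(0, 1)] is a quarter turn of [(1, 0)]. Thus both ends
    of the word are quarter turns; at the right end the shears produced by
    blowing-up are absorbed by [(1, 0)], which they fix. *)
Definition winding (X : seq int) : state :=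
  foldr (fun x v => turn (shear x v)) (0, 1, 0) X.

Lemma shearD k l v : shear k (shear l v) = shear (k + l) v.
Proof. by case: v => [[p q] n] /=; congr (_, _, _); lia. Qed.

Lemma shear0 v : shear 0 v = v.
Proof. by case: v => [[p q] n] /=; congr (_, _, _); lia. Qed.

Lemma valid_shear k v : valid (shear k v) = valid v.
Proof.
case: v => [[p q] n] /=; case: (eqVneq q 0) => [->|//].
by rewrite mulr0 subr0.
Qed.

Lemma valid_turn v : valid v -> valid (turn v).
Proof. by case: v => [[p q] n] /= hv; case: (ltP 0 p) => hp /=; lia. Qed.

Lemma valid_winding X : valid (winding X).
Proof. by elim: X => //= x X IH; rewrite valid_turn ?valid_shear. Qed.

(** The braid relation, which makes [winding] insensitive to blowing-up. *)
Lemma turn_braid v : valid v ->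
  turn (shear (-1) (turn (shear (-1) v))) = shear 1 (turn v).
Proof.
case: v => [[p q] n] /= hv.
case: (ltP 0 (p - -1 * q)) => h1 /=; case: ltP => h2 /=;
  case: (ltP 0 p) => h3 /=; try (exfalso; lia); congr (_, _, _); lia.
Qed.

Lemma turn_turn v : valid v -> turn (turn v) = (v.1.1, v.1.2, v.2 + 1).
Proof.
case: v => [[p q] n] /= hv.
case: (ltP 0 p) => h1 /=; case: ltP => h2 /=;
  try (exfalso; lia); congr (_, _, _); lia.
Qed.

Lemma winding00 X : let v := winding X in
  winding (extl 0 X) = (v.1.1, v.1.2, v.2 + 1).
Proof. by rewrite /= !shear0 turn_turn ?valid_winding. Qed.

Lemma winding_catl s X Y : winding X = winding Y ->
  winding (s ++ X) = winding (s ++ Y).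
Proof. by rewrite /winding !foldr_cat => ->. Qed.

Lemma winding_blowup_head x s :
  winding [:: -1, x - 1 & s] = shear 1 (winding (x :: s)).
Proof.
rewrite /= -turn_braid ?valid_shear ?valid_winding // shearD.
by rewrite [-1 + x]addrC.
Qed.

Lemma winding_blowup X Y : blowup X Y ->
  exists k, winding Y = shear k (winding X).
Proof.
case=> [|x s|s x y t|s x].
- by exists 1.
- by exists 1; apply: winding_blowup_head.
- exists 0; rewrite shear0; apply: winding_catl.
  rewrite -[in RHS](subrK 1 x) [RHS]/= -[in RHS]shearD.
  by rewrite -[shear 1 _]winding_blowup_head.
- exists 0; rewrite shear0; apply: winding_catl.
  by congr (turn (_, _, _)); lia.
Qed.

(** The class of [winding X] up to shears is an invariant: only blowing-up at
    the left end multiplies the word by a power of the shear. *)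
Lemma winding_bequiv X Y : bequiv X Y ->
  exists k, winding Y = shear k (winding X).
Proof.
elim=> [{}X {}Y|{}X|{}X {}Y _ [k ->]|{}X {}Y Z _ [k ->] _ [l ->]].
- exact: winding_blowup.
- by exists 0; rewrite shear0.
- by exists (- k); rewrite shearD addNr shear0.
- by exists (l + k); rewrite shearD.
Qed.

(** * Canonical forms *)

Definition negative (A : seq int) : bool := all (fun a => a <= -2) A.

Inductive canonical : seq int -> Prop :=
| canonical_negative A of negative A : canonical A
| canonical_zero : canonical [:: 0]
| canonical_extl X of canonical X : canonical (extl 0 X).

(** The vector is [(-r, q)], where [q / r] is the value of the negative
    (Hirzebruch-Jung) continued fraction whose terms are the opposites of those
    of [A]; these terms are at least [2], so that [0 <= r < q]. *)
Lemma winding_negative A : negative A ->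
  let: (p, q, n) := winding A in [/\ - q < p, p <= 0 & n = 0].
Proof.
elim: A => [|a A IH] //= /andP[a2 /IH].
case: (winding A) => [[p q] n] /= [h1 h2 ->].
have h : q < p - a * q by nia.
by case: ltP => ?; split; lia.
Qed.

(** The first term is recovered by division with remainder: [p - a * q] with
    [- q < p <= 0] determines [a]. *)
Lemma winding_negative_inj A B : negative A -> negative B ->
  winding A = winding B -> A = B.
Proof.
have step (a p q : int) : a <= -2 -> - q < p -> p <= 0 -> 0 < p - a * q.
  by move=> *; nia.
elim: A B => [|a A IH] [|b B] //=.
- move=> _ /andP[b2 /winding_negative].
  by case: (winding B) => [[p q] n] /= [h1 h2 _]; rewrite step //; case; lia.
- move=> /andP[b2 /winding_negative] + _.
  by case: (winding A) => [[p q] n] /= [h1 h2 _]; rewrite step //; case; lia.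
move=> /andP[a2 nA] /andP[b2 nB].
have := IH B nA nB; have := winding_negative nA; have := winding_negative nB.
case: (winding A) => [[p q] n] /=; case: (winding B) => [[p' q'] n'] /=.
move=> [h1 h2 ->] [h3 h4 ->] eqAB; rewrite !step // => -[eqq e].
have qq : q' = q by lia.
have ab : a = b by nia.
by rewrite ab eqAB // qq; congr (_, _, _); rewrite qq ab in e; lia.
Qed.

(** A quarter turn produces a horizontal vector only by completing a half
    turn. *)
Lemma winding_half_turns X :
  let: (p, q, n) := winding X in 0 <= n /\ (q = 0 -> 1 <= n).
Proof.
elim: X => [|x X] /=; first by split.
have := valid_winding X; case: (winding X) => [[p q] n] /= hv [n0 nq].
by case: (ltP 0 (p - x * q)) => h; split; lia.
Qed.

(** Each pair of zeros in front adds a half turn, and the vector is horizontal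
    exactly when the number of zeros is odd, a single zero having made a half
    turn already; what remains is [winding_negative_inj]. *)
Lemma canonical_inj X Y k : canonical X -> canonical Y ->
  winding Y = shear k (winding X) -> X = Y.
Proof.
move=> cX; elim: cX Y => [A nA||{}X cX IH] Y.
- have := winding_negative nA; case EA: (winding A) => [[p q] n] [h1 h2 n0].
  case=> [B nB||{}Y _].
  + have := winding_negative nB; case EB: (winding B) => [[p' q'] n'].
    move=> [h3 h4 n'0] [ep eq en]; apply: winding_negative_inj => //.
    (* [p] and [p'] are both greater than [-q] and at most [0]. *)
    rewrite EA EB; have k0 : k = 0 by nia.
    by congr (_, _, _); rewrite ?k0 in ep; lia.
  + by case=> *; exfalso; lia.
  + have := winding_half_turns Y; rewrite winding00.
    by case: (winding Y) => [[p' q'] n'] [h3 _] [_ _ e]; exfalso; lia.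
- case=> [B nB|//|{}Y _].
  + have := winding_negative nB; case: (winding B) => [[p q] n] [h1 h2 n0].
    by case=> *; exfalso; lia.
  + have := winding_half_turns Y; rewrite winding00.
    case: (winding Y) => [[p q] n] [h1 h2] [_ h3 h4].
    by have := h2 h3; exfalso; lia.
- have := winding_half_turns X; rewrite winding00.
  case EX: (winding X) => [[p q] n] [h1 h2].
  case=> [B nB||{}Y cY].
  + have := winding_negative nB; case: (winding B) => [[p' q'] n'] [h3 h4 n0].
    by case=> *; exfalso; lia.
  + by case=> _ /esym/h2 h3 e; exfalso; lia.
  + rewrite winding00; case EY: (winding Y) => [[p' q'] n'] [e1 e2 e3].
    congr extl; apply: IH => //; rewrite EX EY /=; congr (_, _, _) => //.
    by lia.
Qed.

(** * Blowing up at a position *)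

Definition decr_head (s : seq int) : seq int :=
  if s is x :: s' then x - 1 :: s' else [::].

Definition decr_last (s : seq int) : seq int := rev (decr_head (rev s)).

Lemma decr_last_rcons s x : decr_last (rcons s x) = rcons s (x - 1).
Proof. by rewrite /decr_last rev_rcons /= rev_cons revK. Qed.

Lemma decr_head_inj : injective decr_head.
Proof. by move=> [|x s] [|y t] //= [/addIr -> ->]. Qed.

Lemma decr_last_inj : injective decr_last.
Proof. by move=> s t /(inv_inj revK)/decr_head_inj/(inv_inj revK). Qed.

(** The four kinds of blowing-up are one: cut the sequence in two, insert [-1],
    and lower the terms next to it, if any. *)
Lemma blowup_cat s t : blowup (s ++ t) (decr_last s ++ -1 :: decr_head t).
Proof.
case: (lastP s) => [|{}s x]; case: t => [|y t]; rewrite ?decr_last_rcons.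
- exact: blowup_nil.
- exact: blowup_first.
- by rewrite cats0 -!cats1 -catA; apply: blowup_last.
- by rewrite !cat_rcons; apply: blowup_mid.
Qed.

Lemma blowupE Y W : blowup Y W ->
  exists s t, Y = s ++ t /\ W = decr_last s ++ -1 :: decr_head t.
Proof.
case=> [|x s|s x y t|s x].
- by exists [::], [::].
- by exists [::], (x :: s).
- by exists (rcons s x), (y :: t); rewrite decr_last_rcons !cat_rcons.
- exists (rcons s x), [::].
  by rewrite decr_last_rcons cats0 -cats1 -[rcons _ (_ - 1)]cats1 -catA.
Qed.

(** A blowing-down is determined by the term [-1] that it removes. *)
Lemma blowdown_unique X Y W : count_mem (-1) W = 1%N ->
  blowup X W -> blowup Y W -> X = Y.
Proof.
move=> c1 /blowupE[s [t [-> defW]]] /blowupE[s' [t' [-> defW']]].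
have idx (u v : seq int) : W = u ++ -1 :: v -> size u = index (-1) W.
  move=> eW; rewrite eW index_cat /= addn0.
  case: ifP => //; rewrite -has_pred1 has_count.
  move: c1; rewrite eW count_cat /= addnCA.
  by move: (count _ u) => [|m]; rewrite ?addnS.
have /eqP := defW'; rewrite {1}defW eqseq_cat; last first.
  by rewrite (idx _ _ defW) (idx _ _ defW').
by rewrite eqseq_cons eqxx => /andP[/eqP/decr_last_inj-> /eqP/decr_head_inj->].
Qed.

Lemma reduction_of_minimal Z : minimal Z -> reduction_of Z Z.
Proof.
move=> mZ; split=> [|Y [_ leYZ]]; first by split=> //; apply: rt_refl.
exact/esym/minimal_ble.
Qed.

(** The last step of a chain from a minimal sequence up to [W'] has to pass
    through [W], the only sequence that [W'] blows down to. *)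
Lemma reduction_of_blowup W W' Z : count_mem (-1) W' = 1%N ->
  blowup W W' -> reduction_of W Z -> reduction_of W' Z.
Proof.
move=> c1 WW' [[mZ leZ] uZ]; split=> [|Y [mY leY]].
  by split=> //; apply: rt_trans leZ _; apply: rt_step.
apply: uZ; split=> //.
case: (clos_rt_rtn1 _ _ _ _ leY) mY WW' c1 => [mY|V V' VV' YV _].
  by move=> /mY.
by move=> WV' c1; rewrite (blowdown_unique c1 WV' VV'); apply: clos_rtn1_rt.
Qed.

(** What [L ++ m + k + 1 :: R] becomes after [k + 1] blowings-up, each just to
    the right of the term displayed. *)
Definition expand (L : seq int) (m : int) (k : nat) (R : seq int) : seq int :=
  L ++ [:: m, -1 & nseq k (-2) ++ decr_head R].

Lemma blowup_expand0 L m R : blowup (L ++ m + 1 :: R) (expand L m 0 R).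
Proof.
have := blowup_cat (rcons L (m + 1)) R.
by rewrite decr_last_rcons !cat_rcons addrK.
Qed.

Lemma blowup_expandS L m k R :
  blowup (expand L (m + 1) k R) (expand L m k.+1 R).
Proof.
have := blowup_cat (rcons L (m + 1)) (-1 :: nseq k (-2) ++ decr_head R).
by rewrite decr_last_rcons !cat_rcons addrK.
Qed.

Lemma bequiv_expand L m k R :
  bequiv (L ++ m + k.+1%:Z :: R) (expand L m k R).
Proof.
elim: k m => [|k IH] m; first exact/rst_step/blowup_expand0.
apply: bequiv_trans (rst_step _ _ _ _ (blowup_expandS _ _ _ _)).
by rewrite (_ : m + k.+2%:Z = m + 1 + k.+1%:Z); [exact: IH | lia].
Qed.

Lemma count_expand L m k R : -1 \notin L -> 0 <= m -> 0 \notin R ->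
  -1 \notin R -> count_mem (-1) (expand L m k R) = 1%N.
Proof.
move=> nL m0 z0 nR; rewrite /expand count_cat /= count_cat.
rewrite (count_memPn nL) count_nseq /= (_ : (m == -1) = false); last by lia.
suff -> : count_mem (-1) (decr_head R) = 0%N by [].
apply/count_memPn; case: R z0 nR => [|r R] //; rewrite !inE /=; lia.
Qed.

(** The term blown up stays nonnegative and the head of [R] is not lowered to
    [-1], so that every sequence met on the way has a single term [-1]. *)
Lemma reduction_of_expand L m k R : minimal (L ++ m + k.+1%:Z :: R) ->
  0 <= m -> 0 \notin R ->
  reduction_of (expand L m k R) (L ++ m + k.+1%:Z :: R).
Proof.
move=> mZ m0 z0; have := mZ; move=> /minimalP.
rewrite mem_cat inE !negb_or => /and3P[nL _ nR].
elim: k m m0 mZ => [|k IH] m m0 mZ.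
  apply: (reduction_of_blowup _ (blowup_expand0 _ _ _)).
    exact: count_expand.
  exact: reduction_of_minimal.
apply: (reduction_of_blowup _ (blowup_expandS _ _ _ _)).
  exact: count_expand.
have e : m + k.+2%:Z = m + 1 + k.+1%:Z by lia.
by rewrite e; apply: IH; rewrite -?e //; lia.
Qed.

(** * Every class has a canonical representative *)

Lemma negative_expand k R : negative R ->
  negative (nseq k (-2) ++ decr_head R).
Proof.
rewrite /negative all_cat all_nseq /= orbT /=.
by case: R => //= r R /andP[r2 ->]; rewrite andbT; lia.
Qed.

(** A nonnegative [x] is blown up to [0]; the term next to this initial [0], if
    any, can then be replaced by [0], and the terms after it are still at most
    [-2]. For [x = -1] blowing down raises the head of [A] to at most [-1],
    whence the induction. *)
Lemma canonical_cons_negative x A : negative A ->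
  exists2 Z, canonical Z & bequiv (x :: A) Z.
Proof.
elim: A x => [|a A IH] x nA.
  case: (ltrgtP x (-1)) => hx.
  - exists [:: x]; last exact: rst_refl.
    by apply: canonical_negative; rewrite /= andbT; lia.
  - have [->|x0] := eqVneq x 0.
      by exists [:: 0]; [exact: canonical_zero | exact: rst_refl].
    exists (extl 0 (nseq `|x - 1|%N (-2))).
      apply/canonical_extl/canonical_negative.
      by rewrite /negative all_nseq orbT.
    apply: bequiv_trans (bequiv_extl (-1) 0 _).
    have := bequiv_expand [::] 0 `|x - 1|%N [::].
    by rewrite /expand /= cats0; congr (bequiv [:: _] _); lia.
  - exists [::]; first exact: canonical_negative.
    by rewrite hx; apply/bequiv_sym/rst_step/blowup_nil.
have /andP[/= a2 nA'] := nA; case: (ltrgtP x (-1)) => hx.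
- exists [:: x, a & A]; last exact: rst_refl.
  by apply: canonical_negative; rewrite /= a2; apply/andP; split=> //; lia.
- have [->|x0] := eqVneq x 0.
    exists (extl 0 A); first exact/canonical_extl/canonical_negative.
    exact: bequiv_extl.
  exists (extl 0 (nseq `|x - 1|%N (-2) ++ decr_head (a :: A))).
    exact/canonical_extl/canonical_negative/negative_expand.
  apply: bequiv_trans (bequiv_extl (-1) 0 _).
  have := bequiv_expand [::] 0 `|x - 1|%N (a :: A).
  by congr (bequiv (_ :: _) _); lia.
- have [Z cZ eqZ] := IH (a + 1) nA'; exists Z => //.
  apply: bequiv_trans eqZ; apply: bequiv_sym; apply: rst_step.
  by rewrite hx -{2}(addrK 1 a); apply: blowup_first.
Qed.

(** Pairs of zeros slide past [x]. *)
Lemma canonical_cons x Y : canonical Y ->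
  exists2 Z, canonical Z & bequiv (x :: Y) Z.
Proof.
move=> cY; elim: cY x => [A nA||{}Y cY IH] x.
- exact: canonical_cons_negative.
- exists (extl 0 [::]); last exact: (bequiv_extr x 0 [::]).
  exact/canonical_extl/canonical_negative.
- have [Z cZ eqZ] := IH x; exists (extl 0 Z); first exact: canonical_extl.
  apply: bequiv_trans (bequiv_extl0 eqZ); apply: bequiv_sym.
  exact: (bequiv_slide [:: x]).
Qed.

(** Blowing-up at the left end becomes, behind a new head, blowing-up at an
    interior place, which lowers the head by one; so prepending a term respects
    equivalence up to a shift of this term. *)
Lemma bequiv_cons X Y : bequiv X Y ->
  exists k, forall x, bequiv (x :: X) (x + k :: Y).
Proof.
elim=> [{}X {}Y h|{}X|{}X {}Y _ [k IH]|{}X {}Y Z _ [k IHk] _ [l IHl]].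
- case: h => [|x1 s|s x1 y t|s x1].
  + by exists (-1) => x; apply/rst_step/(blowup_last [::]).
  + by exists (-1) => x; apply/rst_step/(blowup_mid [::]).
  + by exists 0 => x; rewrite addr0; apply/rst_step/(blowup_mid (x :: s)).
  + by exists 0 => x; rewrite addr0; apply/rst_step/(blowup_last (x :: s)).
- by exists 0 => x; rewrite addr0; apply: rst_refl.
- exists (- k) => x; apply: bequiv_sym.
  by rewrite -{2}(subrK k x); apply: IH.
- exists (k + l) => x; rewrite addrA; apply: bequiv_trans (IHk x) (IHl _).
Qed.

Lemma canonical_exists X : exists2 Z, canonical Z & bequiv X Z.
Proof.
elim: X => [|x X [Y cY /bequiv_cons[k eqXY]]].
  by exists [::]; [exact: canonical_negative | exact: rst_refl].
have [Z cZ eqZ] := canonical_cons (x + k) cY.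
by exists Z => //; apply: bequiv_trans (eqXY x) eqZ.
Qed.

(** The canonical form of [(0, 0, X)] is that of [X] with two more zeros. *)
Lemma bequiv_extl_inj X Y : bequiv (extl 0 X) (extl 0 Y) -> bequiv X Y.
Proof.
have [X' cX eqX] := canonical_exists X; have [Y' cY eqY] := canonical_exists Y.
move=> eqXY.
have [k wk] : exists k, winding (extl 0 Y') = shear k (winding (extl 0 X')).
  apply: winding_bequiv; apply: bequiv_trans (bequiv_extl0 eqY).
  by apply: bequiv_trans eqXY; apply/bequiv_extl0/bequiv_sym.
have [eqX'Y'] := canonical_inj (canonical_extl cX) (canonical_extl cY) wk.
by apply: bequiv_trans eqX _; rewrite eqX'Y'; apply: bequiv_sym.
Qed.

(** * Minimal sequences as members of a successor *)

Lemma minimal_below X : exists2 M, minimal M & ble M X.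
Proof.
have [n] := ubnP (size X); elim: n X => // n IHn X /ltnSE leX.
have [[Y bYX]|nX] := pselect (exists Y, blowup Y X); last first.
  by exists X; [move=> Y bYX; apply: nX; exists Y | exact: rt_refl].
have [|M mM leM] := IHn Y.
  by apply: leq_trans leX; case: bYX => *; rewrite ?size_cat /= ?addnS.
by exists M => //; apply: rt_trans leM _; apply: rt_step.
Qed.

Lemma split_at_cat A m B x y :
  split_at (A ++ m :: B) (size A) x y = A ++ [:: x, 0, y & B].
Proof.
rewrite /split_at take_size_cat // drop_cat ltnNge leqnSn subSnn /=.
by rewrite drop0.
Qed.

Lemma nth_cat_size (A : seq int) m B : (A ++ m :: B)`_(size A) = m.
Proof. by rewrite nth_cat ltnn subnn. Qed.

(** A zero at one end makes [Z] an extension. An interior zero makes [Z] a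
    splitting of the sum of its two neighbours; only a sum equal to [-1]
    prevents the merged sequence from being minimal. *)
Lemma oplus_of_zero Z : minimal Z -> 0 \in Z -> Z != [:: 0] ->
  exists2 M, minimal M & oplus M Z.
Proof.
move=> mZ /[dup] z0; case/splitPr: z0 mZ => L R mZ _.
have rZ := reduction_of_minimal mZ; have /minimalP := mZ.
rewrite mem_cat !inE !negb_or.
case: (lastP L) mZ rZ => [|{}L x] mZ rZ; case: R mZ rZ => [|y R] mZ rZ //.
- rewrite inE negb_or => /and3P[_ _ /andP[_ nR]] _.
  by exists R; [exact/minimalP | exact: oplus_extl rZ].
- rewrite mem_rcons inE negb_or => /andP[/andP[_ nL] _] _.
  exists L; first exact/minimalP.
  by apply: (oplus_extr (x := x)); move: rZ; rewrite cat_rcons.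
rewrite mem_rcons !inE !negb_or cat_rcons.
move=> /and3P[/andP[nx nL] _ /andP[ny nR]] _.
have [xy|xy] := eqVneq (x + y) (-1).
  have [M mM leM] := minimal_below (L ++ -1 :: R); exists M => //.
  rewrite -(split_at_cat L (-1)).
  apply: oplus_blowup (leM) _ _ _ _ _ xy.
  - by rewrite count_cat /= (count_memPn nL) (count_memPn nR).
  - by rewrite size_cat /= addnS leq_addr.
  - exact: nth_cat_size.
  - by apply/eqP; rewrite eq_sym.
  - by apply/eqP; rewrite eq_sym.
exists (L ++ x + y :: R).
  apply/minimalP; rewrite mem_cat inE !negb_or nL nR andbT eq_sym.
  by apply: xy.
apply: (oplus_split (j := size L) (x := x) (y := y)).
- by rewrite size_cat /= addnS leq_addr.
- by rewrite nth_cat_size.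
- by rewrite split_at_cat; move: rZ; rewrite cat_rcons.
Qed.

(** After [z] has been blown up to [0], the [-1] following it serves as the
    right part of a split term, or as the free term of an extension when [z]
    is the first term of [Z]. The neighbours of [z] are lowered by one, but
    not to [-1], since [Z] has no zero. *)
Lemma oplus_of_positive Z z : minimal Z -> 0 \notin Z -> z \in Z -> 0 < z ->
  exists2 M, minimal M & oplus M Z.
Proof.
move=> mZ z0 zZ zpos; case/splitPr: zZ mZ z0 => L R mZ.
have ez : z = 0 + `|z - 1|.+1%:Z by lia.
move: `|z - 1|%N ez => k ez; rewrite {}ez {z zpos} in mZ *.
rewrite mem_cat inE !negb_or => /and3P[zL _ zR].
have rZ := reduction_of_expand mZ (lexx 0) zR.
have /minimalP := mZ; rewrite mem_cat inE !negb_or => /and3P[nL _ nR].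
have nT : -1 \notin nseq k (-2) ++ decr_head R.
  rewrite mem_cat negb_or mem_nseq andbF /=.
  case: R zR nR {mZ rZ} => [|r R] //; rewrite !inE !negb_or /=.
  by move=> /andP[r0 _] /andP[_ ->]; rewrite andbT; lia.
case: (lastP L) mZ rZ zL nL => [|{}L l] mZ rZ zL nL.
  exists (nseq k (-2) ++ decr_head R); first exact/minimalP.
  exact: oplus_extl rZ.
exists (L ++ l - 1 :: nseq k (-2) ++ decr_head R).
  move: zL nL; rewrite !mem_rcons !inE !negb_or => /andP[l0 _] /andP[_ nL].
  by apply/minimalP; rewrite mem_cat inE !negb_or nL nT andbT; lia.
apply: (oplus_split (j := size L) (x := l) (y := -1)).
- by rewrite size_cat /= addnS leq_addr.
- by rewrite nth_cat_size.
- by rewrite split_at_cat; move: rZ; rewrite /expand !cat_rcons.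
Qed.

Lemma oplus_sub_minset C M : bclasses C -> minset C M ->
  oplus M `<=` minset (successor C).
Proof.
move=> hC CM Z MZ; rewrite (successorE hC CM MZ); split; first exact: rst_refl.
case: MZ => [x {}Z [[]]|x {}Z [[]]|j x y {}Z _ _ [[]]
             |M' j x y _ c1 ltj Mj nx ny _] //.
apply/minimalP; move: c1; rewrite -{1}(cat_take_drop j M') (drop_nth 0) // Mj.
rewrite count_cat /= addnCA add1n => -[/eqP].
rewrite addn_eq0 => /andP[/eqP/count_memPn nu /eqP/count_memPn nv].
rewrite /split_at mem_cat !inE !negb_or nu nv !(eq_sym (-1)).
by rewrite (introF eqP nx) (introF eqP ny).
Qed.

Theorem proposition7p1 (C : set (seq int)) (hC : bclasses C) :
  minset (successor C) = \bigcup_(M in minset C) oplus M.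
Proof.
apply/seteqP; split=> Z; last by case=> M CM; apply: oplus_sub_minset.
have [M0 CM0] := minset_nonempty hC; have [X MX] := oplus_nonempty CM0.2.
rewrite (successorE hC CM0 MX) => -[XZ mZ].
have {X MX XZ} eqZ : bequiv (extl 0 M0) Z := bequiv_trans (oplus_bequiv MX) XZ.
suff [M mM MZ] : exists2 M, minimal M & oplus M Z.
  exists M => //; split=> //; have [Y _ defC] := hC.
  move: CM0.1; rewrite -defC => YM0; apply: bequiv_trans YM0 _.
  by apply/bequiv_extl_inj/(bequiv_trans eqZ)/bequiv_sym/oplus_bequiv.
(* [Z] has completed one half turn more than [M0]. *)
have [k] := winding_bequiv eqZ.
have := winding_half_turns M0; rewrite winding00.
case: (winding M0) => [[p q] n] [/= n0 nq] wZ.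
have [z0|z0] := boolP (0 \in Z).
  apply: oplus_of_zero => //; apply/eqP => Z0; move: wZ; rewrite Z0 /=.
  by case=> _ h1 h2; have := nq (esym h1); lia.
have [nZ|] := boolP (negative Z).
  by have := winding_negative nZ; rewrite wZ /= => -[_ _]; lia.
case/allPn=> z zZ z2; apply: (oplus_of_positive mZ z0 zZ).
have /minimalP := mZ => nZ.
have zm : z != -1 by apply: contraNneq nZ => <-.
have z00 : z != 0 by apply: contraNneq z0 => <-.
lia.
Qed.
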